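(* Let $k\subset K$ be a field extension, $A\subset M_n(K)$ a $k$-algebra, and $S\subset K^n$ a simple $K\otimes_kA$-module with $\dim_KS=m$ such that $K^n=S^{\oplus l}$ as $K\otimes_kA$-modules. The open subfunctors $\Phi_i$ ($1\le i\le l$) of $F_A(m,n)$ cover the $K$-rational points of $F_A(m,n)$; that is, $$F_A(m,n)(K)=\bigcup_{i}\Phi_i(h_{\operatorname{Spec}B}(K)).$$ Furthermore, if $K$ is infinite and $A$ is commutative, the open subfunctors $\Phi_i$ of $H_A(m,n)$ cover the $K$-rational points of $H_A(m,n)$.
   Context: Elements of $R^n$ ($R$ a commutative $K$-algebra) are row vectors; $R\otimes_kA$ acts on $R^n$ by $(r\otimes a)\cdot x=r\,xa$. A submodule $M\subset R^n$ is $A$-invariant if it is an $R\otimes_kA$-submodule. Coordinates are chosen compatibly with $K^n=S^{\oplus l}$, so that $n=lm$ and the $i$-th copy of $S$ is given by coordinates $(i-1)m+1,\dots,im$. $G(m,n)(R)$ is the set of free rank $m$ direct summands of $R^n$, functorial by pullback (for $\delta:R\to T$, $M$ goes to the image of $T\otimes_RM$ in $T^n$). $F_A(m,n)(R)\subset G(m,n)(R)$ is the subset of $A$-invariant $M$. $M\in G(m,n)(R)$ is generated by $A$-invariants if the image of $\bigwedge^mM$ in $\bigwedge^mR^n\cong R\otimes_K\bigwedge^mK^n$ has an $R$-module generator of the form $\sum_ir_i\otimes v_{i1}\wedge\cdots\wedge v_{im}$ where each $\{v_{i1},\dots,v_{im}\}$ is a basis of a rank $m$ $A$-invariant subspace of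 $K^n$; $G_A(m,n)(R)$ is the set of such $M$, and $H_A(m,n)(R)=F_A(m,n)(R)\cap G_A(m,n)(R)$. Let $B=K[x_1,\dots,x_{lm-m}]$ and $h_{\operatorname{Spec}B}(R)=\operatorname{Hom}_{K\text{-}\mathsf{alg}}(B,R)$. For $1\le i\le l$, $\Phi_i:h_{\operatorname{Spec}B}\to F_A(m,n)$ is the natural transformation sending $\psi:B\to R$ to the $R\otimes_kA$-submodule of $R^{lm}$ generated by $$(\psi(x_1),\dots,\psi(x_{(i-1)m}),1,0,\dots,0,\psi(x_{(i-1)m+1}),\dots,\psi(x_{lm-m})),$$ where $1,0,\dots,0$ occupy coordinates $(i-1)m+1,\dots,im$. If $K$ is infinite and $A$ is commutative, $\Phi_i$ takes values in $H_A(m,n)$, and the resulting transformation $h_{\operatorname{Spec}B}\to H_A(m,n)$ is also denoted $\Phi_i$.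
   Formalization: For noncommutative A, Φ_i need not take values in F_A(m,n) (e.g. A=M_2(K) on K^4), so the equality for F_A(K) is stated when A is commutative or when every Φ_i maps into F_A(m,n); the inclusion of F_A(K) in the union is proved for all A. *)

(* Defs.v *)
From HB Require Import structures.
From mathcomp Require Import all_boot all_order all_algebra.
From mathcomp Require Import boolp classical_sets functions cardinality.
From mathcomp Require Import mpoly.

Set Implicit Arguments.
Unset Strict Implicit.
Unset Printing Implicit Defensive.

Import GRing.Theory.
Local Open Scope classical_set_scope.
Local Open Scope ring_scope.

(* Row vectors, with matrices acting on the right.  Submodules of R^n, for R
   an arbitrary commutative K-algebra, are classical sets of row vectors, so
   that equality of submodules is equality of sets. *)

(* The field extension k < K is given by iota. *)
Definition is_subalgebra (k K : fieldType) (iota : {rmorphism k -> K})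
    (n : nat) (A : set 'M[K]_n) : Prop :=
  [/\ A 1%:M,
      forall a b, A a -> A b -> A (a - b),
      forall a b, A a -> A b -> A (a *m b)
    & forall c a, A a -> A (iota c *: a)].

Definition commutative_set (K : fieldType) (n : nat) (A : set 'M[K]_n) : Prop :=
  forall a b, A a -> A b -> a *m b = b *m a.

Section OverTheField.
Variables (K : fieldType) (n : nat) (A : set 'M[K]_n).
Implicit Types (S U : {vspace 'rV[K]_n}).

(* Since k acts through K, a subspace of K^n is a K (x)_k A-submodule iff it is
   stable under A. *)
Definition invariant U : Prop :=
  forall a x, A a -> x \in U -> x *m a \in U.

Definition simple_submodule S : Prop :=
  [/\ S != 0%VS, invariant S
    & forall U, invariant U -> (U <= S)%VS -> U = 0%VS \/ U = S].

End OverTheField.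

(* Coordinates i m, ..., (i + 1) m - 1 of K^(l m); i is counted from 0. *)
Definition in_block (m i c : nat) : bool := (i * m <= c < i.+1 * m)%N.

Definition block (K : fieldType) (l m : nat) (i : 'I_l) : set 'rV[K]_(l * m) :=
  [set x | forall c : 'I_(l * m), ~~ in_block m i c -> x 0 c = 0].

(* K^(l m) = S^(+ l) as K (x)_k A-modules, the i-th copy of S being the i-th
   coordinate block: K^(l m) is the direct sum of its blocks, so what remains
   is an A-equivariant K-isomorphism f from S onto each block.  Only the
   restriction of f to S is relevant. *)
Definition sum_of_copies (K : fieldType) (l m : nat) (A : set 'M[K]_(l * m))
    (S : {vspace 'rV[K]_(l * m)}) : Prop :=
  forall i : 'I_l, exists f : 'Hom('rV[K]_(l * m), 'rV[K]_(l * m)),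
    [/\ {in S &, injective f},
        [set f x | x in [set x | x \in S]] = @block K l m i
      & forall a x, A a -> x \in S -> f (x *m a) = f x *m a].

Definition is_submodule (R : nzRingType) (V : lmodType R) (M : set V) : Prop :=
  M 0 /\ forall (r : R) x y, M x -> M y -> M (r *: x + y).

Section Functors.
Variables (K : fieldType) (n : nat) (A : set 'M[K]_n) (m : nat).
Variable R : comAlgType K.
Implicit Types (M N : set 'rV[R]_n).

Definition base_change (p q : nat) (X : 'M[K]_(p, q)) : 'M[R]_(p, q) :=
  map_mx (in_alg R) X.

(* R (x)_k A-submodules: the pure tensors r (x) a generate R (x)_k A, and act
   by x |-> r x a. *)
Definition is_RA_submodule M : Prop :=
  is_submodule M /\ forall a x, A a -> M x -> M (x *m base_change a).

Definition free_of_rank M : Prop :=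
  exists b : 'M[R]_(m, n),
    injective (fun u : 'rV[R]_m => u *m b) /\
    M = range (fun u : 'rV[R]_m => u *m b).

Definition direct_summand M : Prop :=
  is_submodule M /\
  exists N, [/\ is_submodule N, M `&` N = [set 0]
              & forall x, exists y z, [/\ M y, N z & x = y + z]].

Definition Gr : set (set 'rV[R]_n) :=
  [set M | free_of_rank M /\ direct_summand M].

Definition F_A : set (set 'rV[R]_n) :=
  [set M | Gr M /\ is_RA_submodule M].

End Functors.

Arguments Gr {K} n m R.
Arguments F_A {K n} A m R.
Arguments base_change {K} R {p q} X.

(* The m-th exterior power of R^n, as the free module on the basis
   e_f = e_(f 0) /\ ... /\ e_(f (m - 1)), f strictly increasing. *)
Definition wedge_index (m n : nat) : finType :=
  {f : {ffun 'I_m -> 'I_n} |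
    [forall p : 'I_m, forall q : 'I_m, (p < q)%N ==> (f p < f q)%N]}.

Definition ext_power (R : comNzRingType) (m n : nat) : lmodType R :=
  {ffun wedge_index m n -> R^o}.

(* The wedge product of the rows of X: its e_f-coordinate is the m x m minor
   of X on the columns f. *)
Definition wedge (R : comNzRingType) (m n : nat) (X : 'M[R]_(m, n)) :
    ext_power R m n :=
  [ffun f : wedge_index m n => \det (colsub (val f) X)].

Section GeneratedByInvariants.
Variables (K : fieldType) (n : nat) (A : set 'M[K]_n) (m : nat).
Variable R : comAlgType K.
Implicit Types (M : set 'rV[R]_n).

(* Image of the m-th exterior power of M in that of R^n. *)
Definition ext_image M : set (ext_power R m n) :=
  smallest (@is_submodule R (ext_power R m n))
    [set wedge X | X in [set X : 'M[R]_(m, n) | forall p, M (row p X)]].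

Definition invariant_basis (V : 'M[K]_(m, n)) : Prop :=
  exists2 U : {vspace 'rV[K]_n},
    invariant A U & basis_of U [tuple row p V | p < m].

(* A finite sum of r_i (x) v_i1 /\ ... /\ v_im is the list of the pairs
   (r_i, V_i), with V_i the matrix of rows v_i1, ..., v_im; it is mapped to the
   exterior power of R^n by R (x)_K /\^m K^n ~ /\^m R^n. *)
Definition generated_by_invariants M : Prop :=
  exists s : seq (R * 'M[K]_(m, n)),
    (forall t, t \in s -> invariant_basis t.2) /\
    ext_image M =
      range (fun r : R => r *: \sum_(t <- s) t.1 *: wedge (base_change R t.2)).

Definition G_A : set (set 'rV[R]_n) :=
  [set M | Gr n m R M /\ generated_by_invariants M].

Definition H_A : set (set 'rV[R]_n) := F_A A m R `&` G_A.

End GeneratedByInvariants.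

Arguments G_A {K n} A m R.
Arguments H_A {K n} A m R.

Section Phi.
Variables (K : fieldType) (l m : nat) (A : set 'M[K]_(l * m)).

Definition B : comAlgType K := {mpoly K[l * m - m]}.

Definition h_SpecB (R : comAlgType K) : Type := {lrmorphism B -> R}.

(* The variable of index c, counted from 0; the default value 0 is not reached
   in Phi_vector, which only uses c < l m - m. *)
Definition xB (c : nat) : B :=
  if insub c is Some j then 'X_(j : 'I_(l * m - m)) else 0.

Definition Phi_vector (i : 'I_l) (R : comAlgType K) (psi : h_SpecB R) :
    'rV[R]_(l * m) :=
  \row_(c < l * m)
    if (c < i * m)%N then psi (xB c)
    else if (c < i.+1 * m)%N then (c == i * m :> nat)%N%:R
    else psi (xB (c - m)%N).

Definition Phi (i : 'I_l) (R : comAlgType K) (psi : h_SpecB R) :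
    set 'rV[R]_(l * m) :=
  smallest (@is_RA_submodule K (l * m) A R) [set Phi_vector i psi].

(* Phi_i is a transformation from h_(Spec B) to F_A(m, n).  This holds when A
   is commutative, but not in general: for A = M_2(K), acting diagonally on
   K^4 = (K^2)^2, the row (1, 0, 0, 1) generates K^4. *)
Definition Phi_to_F_A : Prop :=
  forall (i : 'I_l) (R : comAlgType K), range (@Phi i R) `<=` F_A A m R.

End Phi.

Arguments Phi {K l m} A i R psi.
Arguments Phi_to_F_A {K l m} A.

(* Main.v *)
(* A acts block-diagonally and each coordinate block is a copy of S, so the
   projection onto a block maps an invariant U to 0 or onto the whole block.  If
   U has dimension m, some projection pr_i is therefore bijective on U, and the
   preimage in U of the first basis vector of block i is a row of the shape
   Phi_vector i psi; it generates U because any nonzero invariant subspace of U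
   still maps onto the block.
   Conversely let A be commutative and x = Phi_vector i psi.  The submodule
   generated by x lies in x D, for D the double commutant of A.  If a in D and
   pr_i (x a) = 0, then the submodule {y in S | y a = 0} is nonzero, so a kills
   S and all its copies: a = 0.  Hence pr_i is injective on the submodule, which
   thus has dimension m.  Over K, the subspace M itself is A-invariant, so the
   wedge of one of its bases is the required generator. *)
Require Import Defs.
From HB Require Import structures.
From mathcomp Require Import all_boot all_order all_algebra.
From mathcomp Require Import boolp classical_sets functions cardinality.
From mathcomp Require Import mpoly.

Set Implicit Arguments.
Unset Strict Implicit.
Unset Printing Implicit Defensive.

Import GRing.Theory.
Local Open Scope classical_set_scope.
Local Open Scope ring_scope.

(* [eqtype.invariant] would shadow it. *)
Local Notation invariant := Defs.invariant.

(** * Equivariant maps and invariant subspaces *)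

(** [f] is total but arbitrary off [U], so that the isomorphisms from [S] onto the blocks
    qualify. *)
Definition equivariant_on (K : fieldType) (n : nat) (A : set 'M[K]_n)
    (U : {vspace 'rV[K]_n}) (f : 'End('rV[K]_n)) : Prop :=
  forall a x, A a -> x \in U -> f (x *m a) = f x *m a.

Lemma invariant_cap_preim (K : fieldType) (n : nat) (A : set 'M[K]_n)
    (U W : {vspace 'rV[K]_n}) (f : 'End('rV[K]_n)) :
  invariant A U -> invariant A W -> equivariant_on A U f ->
  invariant A (U :&: f @^-1: W)%VS.
Proof.
move=> invU invW eqf a x Aa; rewrite !memv_cap -!memv_preim => /andP[Ux Wfx].
by rewrite invU //= eqf // invW.
Qed.

Lemma invariant_img (K : fieldType) (n : nat) (A : set 'M[K]_n)
    (U : {vspace 'rV[K]_n}) (f : 'End('rV[K]_n)) :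
  invariant A U -> equivariant_on A U f -> invariant A (f @: U)%VS.
Proof.
move=> invU eqf a _ Aa /memv_imgP[x Ux ->].
by rewrite -eqf // memv_img // invU.
Qed.

Lemma capv_lker0 (K : fieldType) (V W : vectType K) (f : 'Hom(V, W))
    (U : {vspace V}) :
  {in U &, injective f} -> (U :&: lker f)%VS = 0%VS.
Proof.
move=> injf; apply/eqP; rewrite -subv0; apply/subvP => x.
rewrite memv_cap memv_ker memv0 => /andP[Ux /eqP fx0].
by apply/eqP/injf; rewrite ?mem0v ?linear0.
Qed.

(** * Points over [K]: submodules as subspaces, Grassmannian and wedges *)

(** A subspace of maximal dimension inside [P] is all of [P]: adjoining a further vector of [P]
    would raise the dimension. *)
Lemma submodule_vspace (K : fieldType) (V : vectType K) (P : set V) :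
  is_submodule P -> exists U : {vspace V}, P = [set x | x \in U].
Proof.
move=> [P0 Plin].
pose Q d :=
  `[< exists U : {vspace V}, (forall x, x \in U -> P x) /\ \dim U = d >].
have exQ : exists d, Q d.
  exists 0%N; apply/asboolP; exists 0%VS; rewrite dimv0; split=> // x.
  by rewrite memv0 => /eqP ->.
have Qub d : Q d -> (d <= \dim {:V})%N.
  by move=> /asboolP[U [_ <-]]; rewrite dimvS ?subvf.
case: (ex_maxnP exQ Qub) => d /asboolP[U [UP dimU]] maxd.
exists U; apply/seteqP; split=> x; last exact: UP.
move=> Px; have /maxd: Q (\dim (<[x]> + U)%VS).
  apply/asboolP; exists (<[x]> + U)%VS; split=> // y.
  move=> /memv_addP[z /vlineP[c ->]] [u Uu ->]; apply: Plin => //; exact: UP.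
rewrite -dimU => le_dim /=.
have /eqP -> : U == (<[x]> + U)%VS by rewrite eqEdim addvSr.
by apply/(subvP (addvSl _ _))/memv_line.
Qed.

Lemma base_changeE (K : fieldType) (p q : nat) (X : 'M[K]_(p, q)) :
  base_change K^o X = X.
Proof. by apply/matrixP => i j; rewrite mxE -[LHS]/(X i j * 1) mulr1. Qed.

Lemma RA_submoduleP (K : fieldType) (n : nat) (A : set 'M[K]_n)
    (P : set 'rV[K]_n) :
  is_RA_submodule A (R := K^o) P <->
  exists2 U : {vspace 'rV[K]_n}, invariant A U & P = [set x | x \in U].
Proof.
split=> [[/(@submodule_vspace K 'rV[K]_n)[U ->] inv]|[U inv ->]].
  by exists U => // a x Aa Ux; have := inv _ _ Aa Ux; rewrite base_changeE.
split; last by move=> a x Aa Ux; rewrite base_changeE; exact: inv.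
by split=> [|c x y Ux Uy] /=; rewrite ?mem0v // memvD ?memvZ.
Qed.

Definition vbasis_mx (K : fieldType) (n : nat) (U : {vspace 'rV[K]_n}) :
    'M[K]_(\dim U, n) :=
  \matrix_p (vbasis U)`_p.

Lemma mul_vbasis_mx (K : fieldType) (n : nat) (U : {vspace 'rV[K]_n})
    (u : 'rV[K]_(\dim U)) :
  u *m vbasis_mx U = \sum_p u 0 p *: (vbasis U)`_p.
Proof. by rewrite mulmx_sum_row; apply: eq_bigr => p _; rewrite rowK. Qed.

Lemma range_vbasis_mx (K : fieldType) (n : nat) (U : {vspace 'rV[K]_n}) :
  [set x | x \in U] = range (fun u : 'rV[K]_(\dim U) => u *m vbasis_mx U).
Proof.
apply/seteqP; split=> [x Ux|_ [u _ <-]] /=.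
  exists (\row_p coord (vbasis U) p x) => //.
  rewrite mul_vbasis_mx [RHS](coord_vbasis Ux).
  by apply: eq_bigr => p _; rewrite mxE.
rewrite mul_vbasis_mx memv_suml // => p _.
by rewrite memvZ // vbasis_mem // mem_nth // size_tuple.
Qed.

Lemma vbasis_mx_inj (K : fieldType) (n : nat) (U : {vspace 'rV[K]_n}) :
  injective (fun u : 'rV[K]_(\dim U) => u *m vbasis_mx U).
Proof.
move=> u v /= /eqP; rewrite -subr_eq0 -mulmxBl mul_vbasis_mx => /eqP uv0.
have /freeP fr := basis_free (vbasisP U).
apply/rowP => p; apply/eqP; rewrite -subr_eq0.
by have := fr _ uv0 p; rewrite !mxE => ->.
Qed.

Lemma Gr_vspace (K : fieldType) (n : nat) (U : {vspace 'rV[K]_n}) :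
  Gr n (\dim U) K^o [set x | x \in U].
Proof.
have sub (W : {vspace 'rV[K]_n}) : @is_submodule K^o 'rV[K]_n [set x | x \in W].
  by split=> [|c x y Wx Wy] /=; rewrite ?mem0v // memvD ?memvZ.
split.
  exists (vbasis_mx U); split; last exact: (@range_vbasis_mx K n U).
  exact: (@vbasis_mx_inj K n U).
split; first exact: (sub U).
exists [set x | x \in U^C%VS]; split; first exact: (sub U^C%VS).
  apply/seteqP; split=> [x [Ux Cx]|x ->]; last by split; rewrite /= mem0v.
  have : (x : 'rV[K]_n) \in (U :&: U^C)%VS by rewrite memv_cap; apply/andP.
  by rewrite capv_compl memv0 => /eqP.
move=> x; have : (x : 'rV[K]_n) \in (U + U^C)%VS by rewrite addv_complf memvf.
by case/memv_addP => y Uy [z Cz ->]; exists y, z.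
Qed.

(** A free basis exhibits [U] as the image of an injective linear map from [K^m]. *)
Lemma Gr_dim (K : fieldType) (n m : nat) (U : {vspace 'rV[K]_n}) :
  Gr n m K^o [set x | x \in U] -> \dim U = m.
Proof.
case=> -[b [injb defU]] _.
have -> : U = limg (linfun (mulmxr b : 'rV[K]_m -> 'rV[K]_n)).
  apply/vspaceP => x; apply/idP/memv_imgP => [Ux|[u _ ->]].
    have : [set x | x \in U] x by [].
    by rewrite defU => -[u _ <-]; exists u; rewrite ?memvf ?lfunE.
  have : [set x | x \in U] (u *m b) by rewrite defU; exists u.
  by rewrite lfunE.
rewrite limg_dim_eq ?dimvf /dim /= ?mul1n //.
by apply: capv_lker0 => u v _ _; rewrite !lfunE; exact: injb.
Qed.

(** Selecting columns commutes with multiplication on the left, so each minor gets multiplied by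
    [\det u]. *)
Lemma wedge_mulmx (R : comNzRingType) (m n : nat) (u : 'M[R]_m)
    (X : 'M[R]_(m, n)) :
  wedge (u *m X) = \det u *: wedge X.
Proof.
apply/ffunP => f; rewrite !ffunE -[RHS]/(\det u * \det _) -det_mulmx.
congr (\det _).
by apply/matrixP => p q; rewrite !mxE; apply: eq_bigr => r _; rewrite !mxE.
Qed.

(** The wedge of a basis of [U] is the generator: if the rows of [X] lie in [U], they are
    combinations of that basis, and the wedge of [X] is the determinant of the coefficients times
    the generator. *)
Lemma generated_vspace (K : fieldType) (n : nat) (A : set 'M[K]_n)
    (U : {vspace 'rV[K]_n}) :
  invariant A U ->
  @generated_by_invariants K n A (\dim U) K^o [set x | x \in U].
Proof.
move=> invU; exists [:: (1, vbasis_mx U)]; split.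
  move=> t; rewrite inE => /eqP -> /=; exists U => //.
  have -> : [tuple row p (vbasis_mx U) | p < \dim U] = vbasis U.
    by apply: eq_from_tnth => p; rewrite tnth_mktuple rowK (tnth_nth 0).
  exact: vbasisP.
rewrite big_seq1 /= base_changeE scale1r; apply/seteqP; split.
  move=> w; apply; split=> [|_ [X XU <-]].
    split; first by exists 0; rewrite ?scale0r.
    move=> r _ _ [s _ <-] [t _ <-]; exists (r * s + t) => //.
    by rewrite ?scalerDl ?scalerA.
  have /choice[u uP] p : exists u : 'rV_(\dim U), u *m vbasis_mx U = row p X.
    have := XU p; rewrite range_vbasis_mx => -[u _ eu]; by exists u.
  exists (\det (\matrix_p u p)) => //; rewrite -wedge_mulmx; congr wedge.
  by apply/row_matrixP => p; rewrite row_mul rowK uP.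
move=> _ [r _ <-] P [[P0 Plin] PU]; rewrite -[_ *: _]addr0; apply: Plin => //.
apply: PU; exists (vbasis_mx U) => // p; rewrite rowK /=.
by rewrite vbasis_mem // mem_nth // size_tuple.
Qed.

(** * Coordinate blocks and their projections *)

Section Blocks.
Variables (K : fieldType) (l m : nat).
Implicit Types (i j : 'I_l) (x : 'rV[K]_(l * m)).

Definition block_proj i : 'End('rV[K]_(l * m)) :=
  linfun (mulmxr (diag_mx (\row_c (in_block m i c)%:R))).

Lemma block_projE i x c :
  block_proj i x 0 c = if in_block m i c then x 0 c else 0.
Proof.
by rewrite lfunE /= mul_mx_diag !mxE; case: ifP; rewrite ?mulr1 ?mulr0.
Qed.

Lemma block_proj_id i x : block i x -> block_proj i x = x.
Proof.
move=> bx; apply/rowP => c; rewrite block_projE.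
by case: ifPn => // /bx ->.
Qed.

Lemma mem_block i x : x \in limg (block_proj i) <-> block i x.
Proof.
split=> [/memv_imgP[y _ ->] c /negPf nc|bx]; first by rewrite block_projE nc.
by rewrite -(block_proj_id bx) memv_img ?memvf.
Qed.

Lemma in_blockE i (c : nat) : in_block m i c -> (c %/ m)%N = i.
Proof.
move=> /andP[ge lt].
have m0 : (0 < m)%N by case: m ge lt => //; rewrite !muln0.
by apply/eqP; rewrite eqn_leq -ltnS ltn_divLR // lt leq_divRL.
Qed.

Lemma block_proj_sum x : \sum_i block_proj i x = x.
Proof.
apply/rowP => c; rewrite summxE.
have m0 : (0 < m)%N.
  by have := leq_ltn_trans (leq0n c) (ltn_ord c); rewrite muln_gt0 => /andP[].
(* Coordinate [c] lies in the block of index [c %/ m] and in no other. *)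
have lt_cl : (c %/ m < l)%N by rewrite ltn_divLR.
rewrite (bigD1 (Ordinal lt_cl)) //= block_projE big1 => [|i ne_i].
  by rewrite /in_block leq_divM -ltn_divLR // ltnSn addr0.
rewrite block_projE; case: ifP => // /in_blockE ic.
by case/eqP: ne_i; apply: val_inj.
Qed.

Lemma block_proj_disjoint i j x : i != j -> block i x -> block_proj j x = 0.
Proof.
move=> ne_ij bx; apply/rowP => c; rewrite block_projE mxE.
case: ifP => // /in_blockE jc; rewrite bx //.
by apply: contra ne_ij => /in_blockE ic; apply/eqP/val_inj; rewrite /= -ic -jc.
Qed.

(** Each block component of [x] stays in its block under [a], so the components of [x *m a] are
    those of [x] times [a]. *)
Lemma block_proj_equivariant (A : set 'M[K]_(l * m)) i :
  (forall j, invariant A (limg (block_proj j))) ->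
  equivariant_on A fullv (block_proj i).
Proof.
move=> invb a x Aa _.
have bxa j : block j (block_proj j x *m a).
  by apply/mem_block/invb => //; rewrite memv_img ?memvf.
rewrite -{1}(block_proj_sum x) mulmx_suml linear_sum /= (bigD1 i) //=.
rewrite big1 => [|j ne_ji]; first by rewrite addr0 block_proj_id.
exact: (@block_proj_disjoint j).
Qed.

Definition block_head i : 'rV[K]_(l * m) := \row_c (c == i * m :> nat)%N%:R.

Lemma block_head_neq0 i : (0 < m)%N -> block_head i != 0.
Proof.
move=> m0; have lt_im : (i * m < l * m)%N by rewrite ltn_pmul2r.
apply/eqP => /rowP/(_ (Ordinal lt_im))/eqP.
by rewrite !mxE eqxx oner_eq0.
Qed.

Lemma block_head_block i : (0 < m)%N -> block i (block_head i).
Proof.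
move=> m0 c nc; rewrite mxE; case: eqP => // ec.
by rewrite /in_block ec leqnn ltn_pmul2r // ltnSn in nc.
Qed.

Lemma block_proj_Phi_vector i (psi : h_SpecB l m K^o) : (0 < m)%N ->
  block_proj i (Phi_vector i psi) = block_head i.
Proof.
move=> m0; apply/rowP => c; rewrite block_projE !mxE /in_block.
case: (ltnP c (i * m)%N) => [lt|_] /=.
  by case: eqP => // ec; rewrite ec ltnn in lt.
case: (ltnP c (i.+1 * m)%N) => [//|ge].
by case: eqP => // ec; rewrite ec leq_pmul2r // ltnn in ge.
Qed.

(** [psi] evaluates the variables at the coordinates of [x] outside block [i]; inside it, the
    hypothesis already fixes [x]. *)
Lemma Phi_vector_surj i x : block_proj i x = block_head i ->
  exists psi : h_SpecB l m K^o, Phi_vector i psi = x.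
Proof.
move=> px.
pose x_ (c : nat) : K := if insub c is Some j then x 0 (j : 'I_(l * m)) else 0.
have xE (c : 'I_(l * m)) : x_ c = x 0 c by rewrite /x_ valK.
(* Variables of index at least [i * m] sit after block [i], hence the shift by [m]. All indices used
   stay below [l * m], so the default of [x_] is never reached. *)
pose v (j : 'I_(l * m - m)) :=
  x_ (if (j < i * m)%N then j : nat else (j + m)%N).
have vE (c : nat) : (c < l * m - m)%N ->
    meval v (xB K l m c) = x_ (if (c < i * m)%N then c else (c + m)%N).
  by move=> lt_c; rewrite /xB insubT mevalXU.
exists (meval v : {lrmorphism B K l m -> K^o}).
have le_im : (i * m <= l * m - m)%N.
  rewrite leq_subRL -?mulSn ?leq_mul2r ?ltn_ord ?orbT //.
  by rewrite leq_pmull // (leq_ltn_trans _ (ltn_ord i)).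
apply/rowP => c; rewrite mxE; case: ltnP => [lt|ge].
  rewrite -[LHS]/(meval v (xB K l m c)) vE ?lt ?xE //.
  exact: leq_trans le_im.
case: ltnP => [lt'|ge'].
  by have := block_projE i x c; rewrite px mxE /in_block ge lt'.
have le_mc : (m <= c)%N by apply: leq_trans ge'; rewrite leq_pmull.
rewrite -[LHS]/(meval v (xB K l m (c - m))) vE; last first.
  by rewrite ltn_sub2r // (leq_ltn_trans le_mc).
by rewrite ltnNge leq_subRL // -mulSn ge' subnK // xE.
Qed.

End Blocks.

Arguments block_proj {K l m} i.
Arguments block_head {K l m} i.

(** * Images of invariant subspaces in the blocks *)

Section Isotypic.
Variables (K : fieldType) (l m : nat) (A : set 'M[K]_(l * m)).
Variable S : {vspace 'rV[K]_(l * m)}.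
Hypotheses (simpleS : simple_submodule A S) (dimS : \dim S = m).
Hypothesis copies : sum_of_copies A S.
Implicit Types (i j : 'I_l) (U : {vspace 'rV[K]_(l * m)}).

Let invS : invariant A S. Proof. by case: simpleS. Qed.

Let m_gt0 : (0 < m)%N.
Proof. by case: simpleS => S0 _ _; rewrite -dimS lt0n dimv_eq0. Qed.

Lemma copy_iso i : exists f : 'End('rV[K]_(l * m)),
  [/\ {in S &, injective f}, (f @: S)%VS = limg (block_proj i)
    & equivariant_on A S f].
Proof.
have [f [injf fS eqf]] := copies i; exists f; split=> //.
have memb x : block i x <-> x \in (f @: S)%VS.
  rewrite -fS; split=> [[y Sy <-]|/memv_imgP[y Sy ->]]; first exact: memv_img.
  by exists y.
by apply/vspaceP => x; apply/idP/idP => [/memb/mem_block|/mem_block/memb].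
Qed.

Lemma invariant_block i : invariant A (limg (block_proj i)).
Proof. by have [f [_ <- eqf]] := copy_iso i; exact: invariant_img. Qed.

Lemma block_proj_eqA i : equivariant_on A fullv (block_proj i).
Proof. exact/block_proj_equivariant/invariant_block. Qed.

Lemma dim_block i : \dim (limg (@block_proj K l m i)) = m.
Proof.
have [f [injf <- _]] := copy_iso i.
by rewrite limg_dim_eq // capv_lker0.
Qed.

(** Simplicity is known for [S], so the image is pulled back to [S] along its isomorphism with block
    [i]; the pullback is 0 or [S]. *)
Lemma img_block_proj i U :
  invariant A U -> (block_proj i @: U)%VS != 0%VS ->
  (block_proj i @: U)%VS = limg (block_proj i).
Proof.
move=> invU nz; set W := (_ @: U)%VS in nz *.
have invW : invariant A W.
  by apply: invariant_img => // a x Aa _; rewrite block_proj_eqA ?memvf.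
have sW : (W <= limg (block_proj i))%VS by rewrite limgS ?subvf.
have [f [injf fS eqf]] := copy_iso i.
have [_ _ /(_ (S :&: f @^-1: W)%VS)] := simpleS.
case=> [||W0|defS]; [exact: invariant_cap_preim|exact: capvSl| |].
  case/negP: nz; rewrite -subv0; apply/subvP => x Wx.
  have: x \in (f @: S)%VS by rewrite fS (subvP sW).
  case/memv_imgP => y Sy ex; have : y \in (S :&: f @^-1: W)%VS.
    by rewrite memv_cap Sy -memv_preim -ex.
  by rewrite W0 !memv0 ex => /eqP ->; rewrite linear0.
apply/eqP; rewrite eqEsubv sW -fS; apply/subvP => _ /memv_imgP[y Sy ->].
by move: Sy; rewrite -defS memv_cap -memv_preim => /andP[].
Qed.

Lemma img_block_proj_mem i U x :
  invariant A U -> x \in U -> block_proj i x != 0 ->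
  (block_proj i @: U)%VS = limg (block_proj i).
Proof.
move=> invU Ux nz; apply: img_block_proj => //.
apply: contra nz => /eqP U0; rewrite -memv0 -U0; exact: memv_img.
Qed.

Lemma dim_invariant_ge i U x :
  invariant A U -> x \in U -> block_proj i x != 0 -> (m <= \dim U)%N.
Proof.
move=> invU Ux nz; rewrite -[X in (X <= _)%N](dim_block i).
rewrite -(img_block_proj_mem invU Ux nz).
by rewrite -(limg_ker_dim (block_proj i) U) leq_addl.
Qed.

(** * The submodule generated by a row, and the inclusion of [F_A] *)

(** The intersection of all submodules containing the row is again one, hence over [K] an invariant
    subspace, minimal among those containing the row. *)
Lemma Phi_vspace i (psi : h_SpecB l m K^o) :
  exists U, [/\ invariant A U, Phi A i K^o psi = [set x | x \in U],
    Phi_vector i psi \in U & forall W, invariant A W ->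
      Phi_vector i psi \in W -> (U <= W)%VS].
Proof.
have /RA_submoduleP[U invU defU] : is_RA_submodule A (Phi A i K^o psi).
  split; [split|].
  - by move=> P [[[P0 _] _] _].
  - move=> r x y Px Py P rsP; have [[[_ Plin] _] _] := rsP.
    by apply: Plin; [exact: Px|exact: Py].
  - move=> a x Aa Px P rsP; have [[_ Pa] _] := rsP.
    exact: (Pa _ _ Aa (Px _ rsP)).
exists U; split=> //.
  have : Phi A i K^o psi (Phi_vector i psi) by move=> P [_]; apply.
  by rewrite defU.
move=> W invW Wx; apply/subvP => y Uy.
have : Phi A i K^o psi y by rewrite defU.
move/(_ [set z | z \in W]); apply; split; last by move=> _ ->.
by apply/RA_submoduleP; exists W.
Qed.

Lemma F_A_sub_Phi :
  F_A A m K^o `<=` \bigcup_(i in [set: 'I_l]) range (Phi A i K^o).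
Proof.
move=> M [GrM /RA_submoduleP[U invU defM]].
move: GrM; rewrite {}defM => /Gr_dim dimU.
(* The projections sum to the identity, so they cannot all vanish on [U], whose dimension [m] is
   positive. *)
have [i nz] : exists i, (block_proj i @: U)%VS != 0%VS.
  apply: contrapT => no; have : U = 0%VS.
    apply/eqP; rewrite -subv0; apply/subvP => x Ux; rewrite memv0.
    apply/eqP; rewrite -(block_proj_sum x) big1 // => i _; apply/eqP.
    rewrite -memv0; apply: contrapT => nzi; apply: no; exists i.
    by apply/eqP => i0; apply: nzi; rewrite -i0 memv_img.
  by move=> U0; move: m_gt0; rewrite -dimU U0 dimv0.
have : block_head i \in (block_proj i @: U)%VS.
  by rewrite img_block_proj //; apply/mem_block/block_head_block.
case/memv_imgP => x Ux /esym px; have [psi defx] := Phi_vector_surj px.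
exists i => //; exists psi => //.
have [W [invW -> Wx minW]] := Phi_vspace i psi.
suff -> : W = U by [].
(* [W] lies in [U] by minimality, and has dimension at least [m] because its row projects to the
   nonzero [block_head]. *)
apply/eqP; rewrite eqEdim minW ?defx //= dimU.
by apply: (@dim_invariant_ge i _ _ invW Wx); rewrite defx px block_head_neq0.
Qed.

(** * The double commutant and the reverse inclusion *)

(* Stability under A-equivariant maps out of arbitrary invariant subspaces, and
   not only out of K^(l m), lets the isomorphisms of S with the blocks be used
   without extending them. *)
Definition double_commutant : set 'M[K]_(l * m) :=
  [set a | forall U f, invariant A U -> equivariant_on A U f ->
     forall x, x \in U -> x *m a \in U /\ f (x *m a) = f x *m a].

Lemma sub_double_commutant : A `<=` double_commutant.
Proof. by move=> a Aa U f invU eqf x Ux; rewrite invU ?eqf. Qed.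

Lemma double_commutant1 : double_commutant 1%:M.
Proof. by move=> U f _ _ x; rewrite !mulmx1. Qed.

Lemma double_commutantM a b :
  double_commutant a -> double_commutant b -> double_commutant (a *m b).
Proof.
move=> Da Db U f invU eqf x Ux; rewrite !mulmxA.
have [Uxa <-] := Da U f invU eqf x Ux.
exact: (Db U f).
Qed.

Lemma double_commutantD c a b :
  double_commutant a -> double_commutant b -> double_commutant (c *: a + b).
Proof.
move=> Da Db U f invU eqf x Ux.
have [Uxa fxa] := Da U f invU eqf x Ux; have [Uxb fxb] := Db U f invU eqf x Ux.
by rewrite !mulmxDr -!scalemxAr memvD ?memvZ // linearD linearZ /= fxa fxb.
Qed.

(* The vectors of S killed by a form a submodule, so a kills S, hence every
   block. *)
Lemma double_commutant_eq0 i a x : commutative_set A -> double_commutant a ->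
  block_proj i x != 0 -> block_proj i (x *m a) = 0 -> a = 0.
Proof.
move=> commA Da nz pxa0.
(* Since [A] is commutative, right multiplication by [b] is itself equivariant, so [a] must commute
   with it. *)
have eqb b : A b -> equivariant_on A fullv (linfun (mulmxr b)).
  by move=> Ab c y Ac _; rewrite !lfunE /= -!mulmxA commA.
have invf : invariant A fullv by move=> *; rewrite memvf.
have comm b : A b -> forall y : 'rV[K]_(l * m), y *m a *m b = y *m b *m a.
  move=> Ab y; have [_] := Da _ _ invf (eqb b Ab) y (memvf _).
  by rewrite !lfunE.
pose N := lker (linfun (mulmxr a : 'rV[K]_(l * m) -> 'rV[K]_(l * m))).
have memN y : (y \in N) = (y *m a == 0) by rewrite memv_ker lfunE.
have invN : invariant A N.
  by move=> b y Ab; rewrite !memN -comm // => /eqP ->; rewrite mul0mx.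
have SN : (S <= N)%VS.
  have [f [injf fS eqf]] := copy_iso i.
  have [_ _ /(_ (S :&: N)%VS)] := simpleS.
  case=> [|||<-]; [|exact: capvSl| |exact: capvSr].
    by move=> b y Ab; rewrite !memv_cap => /andP[Sy Ny]; rewrite invS ?invN.
  move=> SN0; case/negP: nz.
  have : block_proj i x \in (f @: S)%VS by rewrite fS memv_img ?memvf.
  (* [y] is the counterpart in [S] of the projection of [x]. Then [f (y *m a) = 0] puts [y] in
     [S :&: N], which is 0, against [block_proj i x != 0]. *)
  case/memv_imgP => y Sy ey.
  have pa : block_proj i x *m a = 0.
    have [_ <-] := Da _ _ invf (@block_proj_eqA i) x (memvf _).
    exact: pxa0.
  have [Sya fya] := Da _ _ invS eqf y Sy.
  have : y \in (S :&: N)%VS.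
    rewrite memv_cap Sy memN; apply/eqP/injf; rewrite ?mem0v //.
    by rewrite fya -ey pa linear0.
  by rewrite SN0 memv0 ey => /eqP ->; rewrite linear0.
(* Each row of [a] is the image of a unit vector, whose block components come from vectors of [S],
   all killed by [a]. *)
apply/row_matrixP => r; rewrite row0 rowE -(block_proj_sum (delta_mx 0 r)).
rewrite mulmx_suml big1 // => j _.
have [f [injf fS eqf]] := copy_iso j.
have : block_proj j (delta_mx 0 r) \in (f @: S)%VS.
  by rewrite fS memv_img ?memvf.
case/memv_imgP => y Sy ->; have [_ <-] := Da _ _ invS eqf y Sy.
by move/subvP/(_ y Sy): SN; rewrite memN => /eqP ->; rewrite linear0.
Qed.

(** The projection maps the submodule onto block [i], and commutativity makes it injective there. *)
Lemma Phi_dim i (psi : h_SpecB l m K^o) U : commutative_set A ->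
  Phi A i K^o psi = [set x | x \in U] -> \dim U = m.
Proof.
move=> commA; have [U' [invU -> Ux minU]] := Phi_vspace i psi.
move=> eU; have {eU} <- : U' = U.
  case/seteqP: eU => UU' U'U.
  by apply/vspaceP => y; apply/idP/idP => [/UU'|/U'U].
set x := Phi_vector i psi in Ux minU.
have nzx : block_proj i x != 0.
  by rewrite block_proj_Phi_vector ?block_head_neq0.
rewrite -[RHS](dim_block i) -(img_block_proj_mem invU Ux nzx) limg_dim_eq //.
(* The multiples of [x] by the double commutant form an [A]-stable subspace containing [x], so every
   vector of [U'] has the form [x *m a]. *)
have /(@submodule_vspace K 'rV[K]_(l * m))[W defW] :
    is_submodule [set x *m a | a in double_commutant].
  split.
    exists 0; rewrite ?mulmx0 // => V f _ _ y _.
    by rewrite !mulmx0 linear0 mem0v.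
  move=> r _ _ [a Da <-] [b Db <-]; exists (r *: a + b).
    exact: double_commutantD.
  by rewrite mulmxDr scalemxAr.
have memW y : y \in W -> exists2 a, double_commutant a & y = x *m a.
  move=> Wy; have : [set` W] y by [].
  by rewrite -defW => -[a Da <-]; exists a.
have memxW a : double_commutant a -> x *m a \in W.
  move=> Da; have : [set x *m a | a in double_commutant] (x *m a) by exists a.
  by rewrite defW.
have UW : (U' <= W)%VS.
  apply: minU => [b y Ab /memW[a Da ->]|].
    rewrite -mulmxA; apply/memxW/double_commutantM => //.
    exact: sub_double_commutant.
  by rewrite -[X in X \in _]mulmx1; apply/memxW/double_commutant1.
apply/eqP; rewrite -subv0; apply/subvP => y; rewrite memv_cap memv_ker.
case/andP => /(subvP UW)/memW[a Da ->] /eqP pxa0.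
by rewrite (double_commutant_eq0 commA Da nzx pxa0) mulmx0 mem0v.
Qed.

(** The dimension is the crux: an invariant subspace of dimension [m] is a point of both [F_A] and
    [G_A]. *)
Lemma Phi_sub_H_A : commutative_set A ->
  \bigcup_(i in [set: 'I_l]) range (Phi A i K^o) `<=` H_A A m K^o.
Proof.
move=> commA _ [i _ [psi _ <-]].
have [U [invU defP _ _]] := Phi_vspace i psi.
have dimU := Phi_dim commA defP; rewrite defP.
have GrU : Gr (l * m) m K^o [set x | x \in U].
  by rewrite -[X in Gr _ X]dimU; exact: Gr_vspace.
split; split=> //; first by apply/RA_submoduleP; exists U.
by have := generated_vspace invU; rewrite dimU.
Qed.

End Isotypic.

(** For noncommutative [A] the rows may generate submodules outside [F_A], hence the disjunction in
    the second clause. *)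
Theorem corollary4p7 (k K : fieldType) (iota : {rmorphism k -> K}) (l m : nat)
    (A : set 'M[K]_(l * m)) (hA : is_subalgebra iota A)
    (S : {vspace 'rV[K]_(l * m)}) (hS : simple_submodule A S)
    (dimS : \dim S = m) (hdec : sum_of_copies A S) :
  [/\ F_A A m K^o `<=` \bigcup_(i in [set: 'I_l]) range (Phi A i K^o),
      commutative_set A \/ Phi_to_F_A A ->
        F_A A m K^o = \bigcup_(i in [set: 'I_l]) range (Phi A i K^o)
    & infinite_set [set: K] -> commutative_set A ->
        H_A A m K^o = \bigcup_(i in [set: 'I_l]) range (Phi A i K^o)].
Proof.
have sub := F_A_sub_Phi hS dimS hdec.
have sup commA := @Phi_sub_H_A _ _ _ _ _ hS dimS hdec commA.
split=> // [[commA|PhiF]|_ commA]; apply/seteqP; split=> // M.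
- by move/(sup commA) => [].
- by case=> i _ /PhiF.
- by case=> /sub.
- exact: sup.
Qed.
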